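(* Let $\mathcal{F}_4^{\mathrm{sp}}=\{K_5,G_1,G_2,G_3,G_4,G_5\}$. If $G$ is a split graph, then $G$ is star $4$-colorable if and only if $G$ is $\mathcal{F}_4^{\mathrm{sp}}$-free, that is, no induced subgraph of $G$ is isomorphic to a member of $\mathcal{F}_4^{\mathrm{sp}}$.
   Context: Graphs are finite, with no loops or parallel edges. A star coloring of $G$ is a proper vertex coloring in which no path on four vertices (as a not necessarily induced subgraph) uses only two colors; $G$ is star $k$-colorable if it has a star coloring using at most $k$ colors. A split graph is a graph whose vertex set can be partitioned into a clique $K$ and an independent set $S$. Each of $G_1,\dots,G_5$ is a split graph with clique $K=\{1,2,3,4\}$ and an independent set $S$ (disjoint from $K$) having exactly one vertex for each of the listed neighborhoods (subsets of $K$): $G_1$: $\{1,2,3\},\{4\}$; $G_2$: $\{1,2,3\},\{3,4\}$; $G_3$: $\{1,2,3\},\{2,3,4\}$; $G_4$: $\{1,2\},\{3,4\}$; $G_5$: $\{1\},\{2,3\},\{2,4\},\{3,4\}$. *)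

(* Defs.v *)
From mathcomp Require Import all_boot.

Set Implicit Arguments.
Unset Strict Implicit.
Unset Printing Implicit Defensive.

Record sgraph := SGraph {
  vertex :> finType;
  edge : rel vertex;
  edge_sym : symmetric edge;
  edge_irrefl : irreflexive edge
}.

Section GraphNotions.
Variable G : sgraph.

Definition clique (K : {set G}) : Prop :=
  {in K &, forall x y, x != y -> edge x y}.

Definition independent (S : {set G}) : Prop :=
  {in S &, forall x y, ~~ edge x y}.

Definition split_graph : Prop :=
  exists K S : {set G},
    [/\ K :|: S = [set: G], [disjoint K & S], clique K & independent S].

Definition proper_coloring (k : nat) (c : G -> 'I_k) : Prop :=
  forall x y : G, edge x y -> c x != c y.

(* A path on four vertices, not necessarily induced. *)
Definition is_P4 (x y z w : G) : bool :=
  uniq [:: x; y; z; w] && path (@edge G) x [:: y; z; w].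

Definition star_coloring (k : nat) (c : G -> 'I_k) : Prop :=
  proper_coloring c /\
  forall x y z w : G, is_P4 x y z w -> #|[set c x; c y; c z; c w]| != 2.

Definition star_colorable (k : nat) : Prop :=
  exists c : G -> 'I_k, star_coloring c.

Section Induced.
Variable A : {set G}.

Definition induced_edge : rel {x : G | x \in A} :=
  fun u v => edge (val u) (val v).

Lemma induced_edge_sym : symmetric induced_edge.
Proof. by move=> u v; apply: edge_sym. Qed.

Lemma induced_edge_irrefl : irreflexive induced_edge.
Proof. by move=> u; apply: edge_irrefl. Qed.

Definition induced : sgraph := SGraph induced_edge_sym induced_edge_irrefl.
End Induced.

End GraphNotions.

Definition isomorphic (G H : sgraph) : Prop :=
  exists f : G -> H, bijective f /\ forall x y, edge (f x) (f y) = edge x y.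

Definition is_free (F : sgraph -> Prop) (G : sgraph) : Prop :=
  forall H : sgraph, F H -> ~ exists A : {set G}, isomorphic (induced A) H.

Section Complete.
Variable n : nat.

Definition complete_edge : rel 'I_n := fun i j => i != j.

Lemma complete_edge_sym : symmetric complete_edge.
Proof. by move=> i j; rewrite /complete_edge eq_sym. Qed.

Lemma complete_edge_irrefl : irreflexive complete_edge.
Proof. by move=> i; rewrite /complete_edge eqxx. Qed.

Definition complete : sgraph := SGraph complete_edge_sym complete_edge_irrefl.
End Complete.

(* [split_of n N]: the clique is {1, ..., n}, with [inl i] standing for the
   vertex i + 1; the vertex [inr j] of the independent set has neighborhood
   the j-th entry of [N], written with the labels 1, ..., n. *)
Section SplitOf.
Variables (n : nat) (N : seq (seq nat)).

Definition split_of_edge : rel ('I_n + 'I_(size N)) := fun u v =>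
  match u, v with
  | inl i, inl i' => i != i'
  | inl i, inr j | inr j, inl i => i.+1 \in nth [::] N j
  | inr _, inr _ => false
  end.

Lemma split_of_edge_sym : symmetric split_of_edge.
Proof. by move=> [i|j] [i'|j'] //=; rewrite eq_sym. Qed.

Lemma split_of_edge_irrefl : irreflexive split_of_edge.
Proof. by move=> [i|j] //=; rewrite eqxx. Qed.

Definition split_of : sgraph := SGraph split_of_edge_sym split_of_edge_irrefl.
End SplitOf.

Definition G1 : sgraph := split_of 4 [:: [:: 1; 2; 3]; [:: 4]].
Definition G2 : sgraph := split_of 4 [:: [:: 1; 2; 3]; [:: 3; 4]].
Definition G3 : sgraph := split_of 4 [:: [:: 1; 2; 3]; [:: 2; 3; 4]].
Definition G4 : sgraph := split_of 4 [:: [:: 1; 2]; [:: 3; 4]].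
Definition G5 : sgraph := split_of 4 [:: [:: 1]; [:: 2; 3]; [:: 2; 4]; [:: 3; 4]].

Definition F4sp (H : sgraph) : Prop :=
  H = complete 5 \/ H = G1 \/ H = G2 \/ H = G3 \/ H = G4 \/ H = G5.

(* Main.v *)
Require Import Defs.
From mathcomp Require Import all_boot.

Set Implicit Arguments.
Unset Strict Implicit.
Unset Printing Implicit Defensive.

(** Let [G] be split with clique [K] and independent set [S = ~: K].  Only the
    case of exactly four clique vertices is interesting: with five there is a
    [K5], and with at most three one color is left over for all of [S].

    When [#|K| = 4] the clique uses every color, so the color of [s] in [S] is
    that of a clique vertex [k s], necessarily one of the vertices of [K] that
    [s] misses.  A bicolored path on four vertices can only run
    [s - k t - k s - t] with [s, t] in [S].  Hence star 4-colorings amount to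
    selections: maps [k] with [k s] in the missing set [M(s)] such that, for all
    [s] and [t], [k t] is in [M(s)] or [k s] is in [M(t)]
    ([star_colorable_selection], [selection_star_colorable]).

    Seen this way, the graphs of the list are the obstructions to a selection.
    Two disjoint missing sets admit none.  An empty one is a [K5]; for nonempty
    ones the sizes (1,3), (1,2), (1,1), (2,2) are exactly [G1], [G2], [G3], [G4]
    ([disjoint_missing]).  The graph [G5] has the missing sets
    [bcd, ad, ac, ab], which admit none either.  As star colorings restrict to
    induced subgraphs, one direction follows.

    Conversely, take pairwise intersecting missing sets ([selection_of_family]).
    If they share a point, choose it always.  If some three points [a, b, c] of
    [K] are such that every missing set contains two of them, choose cyclically:
    [a] from [ab], [b] from [bc], [c] from [ca], and any of these when all three
    are present.  If both fail, every point of [K] lies in a two-element missing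
    set; pairwise intersecting pairs that cover four points form a star
    [ab, ac, ad], and a missing set that avoids the center [a] meets all three
    pairs, so it is [bcd]: this is [G5]. *)

(** * Induced copies *)

Definition embeds (H G : sgraph) : Prop :=
  exists f : H -> G, injective f /\ forall x y, edge (f x) (f y) = edge x y.

Lemma induced_copyP (G H : sgraph) :
  (exists A : {set G}, isomorphic (induced A) H) <-> embeds H G.
Proof.
split=> [[A [f [[g fK gK] f_edge]]]|[f [f_inj f_edge]]].
  exists (val \o g); split=> [|x y /=].
    by apply: inj_comp; [apply: val_inj | apply: can_inj gK].
  by rewrite -{2}(gK x) -{2}(gK y) f_edge.
pose A := [set f x | x : H].
have fA x : f x \in A by apply: imset_f.
pose g x : induced A := Sub (f x) (fA x).
have g_inj : injective g by move=> x y /(congr1 val)/f_inj.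
have val_g x : val (g x) = f x by [].
have gA u : exists x, g x == u.
  have /imsetP[x _ ux] := valP u; exists x; apply/eqP/val_inj.
  by rewrite /= -ux.
exists A, (fun u => xchoose (gA u)); split=> [|u v]; last first.
  rewrite -f_edge -[RHS]/(edge (val u) (val v)) -!val_g.
  by rewrite !(eqP (xchooseP (gA _))).
exists g => [u|x]; first exact/eqP/(xchooseP (gA u)).
exact/g_inj/eqP/(xchooseP (gA (g x))).
Qed.

Lemma star_colorable_embeds (G H : sgraph) n :
  embeds H G -> star_colorable G n -> star_colorable H n.
Proof.
move=> [f [f_inj f_edge]] [c [c_proper c_star]].
exists (c \o f); split=> [x y xy|x y z w P4].
  by apply: c_proper; rewrite f_edge.
apply: c_star; move: P4; rewrite /is_P4 /= !f_edge.
by rewrite !inE !(inj_eq f_inj).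
Qed.

(** * Star colorings with a clique and an independent set *)

Lemma alternating (T : finType) (p q r t : T) :
  p != q -> q != r -> r != t -> #|[set p; q; r; t]| = 2 -> p = r /\ q = t.
Proof.
move=> pq qr rt card2.
have sub (x : T) : x \in [set p; q; r; t] -> (x == p) || (x == q).
  suff /eqP <- : [set p; q] == [set p; q; r; t] by rewrite !inE.
  rewrite eqEcard card2 cards2 pq leqnn andbT.
  by apply/subsetP=> y; rewrite !inE => /orP[]->; rewrite ?orbT.
have /orP[/eqP rp|] : (r == p) || (r == q).
- by apply: sub; rewrite !inE eqxx !orbT.
- have /orP[/eqP tp|/eqP->//] : (t == p) || (t == q).
    by apply: sub; rewrite !inE eqxx !orbT.
  by rewrite rp tp eqxx in rt.
- by rewrite eq_sym (negPf qr).
Qed.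

(** In a proper coloring a path on four vertices with two colors must alternate
    them, which is easier to refute than a cardinality. *)
Lemma star_coloringI (G : sgraph) n (c : G -> 'I_n) :
  proper_coloring c ->
  (forall x y z w, is_P4 x y z w -> c x = c z -> c y = c w -> False) ->
  star_coloring c.
Proof.
move=> c_proper c_alt; split=> // x y z w P4; apply/eqP => card2.
have /and4P[xy yz zw _] : path (@edge G) x [:: y; z; w] by case/andP: P4.
have [] := alternating (c_proper _ _ xy) (c_proper _ _ yz) (c_proper _ _ zw).
  exact: card2.
exact: c_alt P4.
Qed.

(** Give distinct colors to [K] and one further color to the independent rest.
    An alternating path would put two vertices in each of its color classes,
    yet only the further color is used more than once. *)
Lemma independent_star_colorable (G : sgraph) (K : {set G}) n :
  independent (~: K) -> #|K| < n -> star_colorable G n.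
Proof.
move=> indepS ltKn.
(* The index of a vertex outside [K] is the size of the enumeration, which
   serves as the further color. *)
have lt_index x : index x (enum K) < n.
  by apply: leq_ltn_trans ltKn; rewrite cardE index_size.
pose c x := Ordinal (lt_index x).
have c_inj x y : x \in K -> c x = c y -> x = y.
  move=> xK /(congr1 val) /= ixy; have xE : x \in enum K by rewrite mem_enum.
  have yE : y \in enum K by rewrite -index_mem -ixy index_mem.
  by rewrite -(nth_index x xE) ixy nth_index.
exists c; apply: star_coloringI => [x y xy|x y z w].
  apply/eqP => cxy; have [xK|xS] := boolP (x \in K).
    by rewrite -(c_inj _ _ xK cxy) edge_irrefl in xy.
  have [yK|yS] := boolP (y \in K).
    by rewrite -(c_inj _ _ yK (esym cxy)) edge_irrefl in xy.
  by have := indepS x y; rewrite !inE xS yS xy => /(_ isT isT).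
rewrite /is_P4 /= !inE !negb_or.
move=> /andP[/and4P[/and3P[_ xz _] /andP[_ yw] _ _] /and4P[xy _ _ _]] cxz cyw.
have xS : x \notin K by apply: contra_neqN xz => /c_inj; apply.
have yS : y \notin K by apply: contra_neqN yw => /c_inj; apply.
by have := indepS x y; rewrite !inE xS yS xy => /(_ isT isT).
Qed.

(** [k s] stands for the clique vertex that shares its color with [s]; the
    second condition excludes the bicolored path [s - k t - k s - t]. *)
Definition selection (G : sgraph) (K : {set G}) (k : G -> G) : Prop :=
  (forall s, s \notin K -> k s \in K /\ ~~ edge s (k s)) /\
  (forall s t, s \notin K -> t \notin K -> ~~ (edge s (k t) && edge t (k s))).

(** A clique of size [n] uses all [n] colors, so every color outside the clique
    is also the color of a unique clique vertex. *)
Lemma star_colorable_selection (G : sgraph) (K : {set G}) n :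
  clique K -> #|K| = n -> star_colorable G n -> exists k, selection K k.
Proof.
move=> cliqueK cardK [c [c_proper c_star]].
have c_inj : {in K &, injective c}.
  move=> x y xK yK cxy; apply: contra_eq cxy => xy.
  exact/c_proper/cliqueK.
have c_onto (i : 'I_n) : i \in c @: K.
  suff /eqP-> : c @: K == setT by [].
  by rewrite eqEcard subsetT cardsT card_ord card_in_imset // cardK leqnn.
have kP s : exists x, (x \in K) && (c x == c s).
  by have /imsetP[x xK cx] := c_onto (c s); exists x; rewrite xK cx eqxx.
pose k s := xchoose (kP s).
have kK s : k s \in K by case/andP: (xchooseP (kP s)).
have ck s : c (k s) = c s by case/andP: (xchooseP (kP s)) => _ /eqP.
have not_adj s : ~~ edge s (k s).
  by apply/negP=> /c_proper; rewrite ck eqxx.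
exists k; split=> [s _|s t sK tK]; first by split.
apply/negP=> /andP[st ts].
have kts : k t != k s by apply: contraTneq st => ->; apply: not_adj.
have neq_st : s != t by apply: contraTneq st => ->; apply: not_adj.
have: is_P4 s (k t) (k s) t.
  rewrite /is_P4 /= st (cliqueK _ _ _ _ kts) ?kK // edge_sym ts !andbT.
  by rewrite !inE !negb_or neq_st kts !(eq_sym s) ?(memPn sK) ?(memPn tK).
move/c_star; rewrite !ck; suff ->: [set c s; c t; c s; c t] = [set c s; c t].
  by rewrite cards2 -(ck t) c_proper.
by apply/setP=> i; rewrite !inE; do 2?case: (i == _).
Qed.

(** Color [s] like [k s].  Each color then occurs once in [K] and no edge avoids
    [K], so the only shape left for an alternating path is the one that a
    selection excludes. *)
Lemma selection_star_colorable (G : sgraph) (K : {set G}) n k :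
  independent (~: K) -> #|K| = n -> selection K k -> star_colorable G n.
Proof.
move=> indepS cardK [kP k_pair].
have S_edge x y : edge x y -> x \notin K -> y \in K.
  move=> xy xS; apply: contraLR xy => yS.
  by apply: indepS; rewrite inE.
pose rep x := if x \in K then x else k x.
have repK x : rep x \in K by rewrite /rep; case: ifPn => // /kP[].
have lt_index x : index (rep x) (enum K) < n.
  by rewrite -cardK cardE index_mem mem_enum.
pose c x := Ordinal (lt_index x).
have c_rep x y : c x = c y -> rep x = rep y.
  move=> /(congr1 val) /= ixy.
  by rewrite -(@nth_index _ x (rep x) (enum K)) ?ixy ?nth_index ?mem_enum.
have rep_neq x y : edge x y -> rep x != rep y.
  wlog xK : x y / x \in K => [W xy|xy].
    have [/W|/(S_edge _ _ xy)/W] := boolP (x \in K); first exact.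
    by rewrite eq_sym; apply; rewrite edge_sym.
  rewrite /rep xK; case: ifPn => [_|/kP[_ yk]].
    by apply: contraTneq xy => ->; rewrite edge_irrefl.
  by apply: contraTneq xy => ->; rewrite edge_sym.
exists c; apply: star_coloringI => [x y xy|x y z w P4 /c_rep xz /c_rep yw].
  by apply: contra_neq (rep_neq _ _ xy) => /c_rep.
move: P4; rewrite /is_P4 /= !inE !negb_or.
move=> /andP[/and4P[/and3P[_ xz' _] /andP[_ yw'] _ _] /and4P[xy yz zw _]].
move: xz yw; rewrite /rep.
have zx : edge y x by rewrite edge_sym.
have wz : edge w z by rewrite edge_sym.
have zy : edge z y by rewrite edge_sym.
(* As [K] repeats no color and no edge lies outside it, [y] and [z] are in [K]
   while [x] and [w] are not; every other distribution is contradictory. *)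
have [xK|xS] := boolP (x \in K); have [zK|zS] := boolP (z \in K).
- by move=> E; rewrite E eqxx in xz'.
- have yK := S_edge _ _ zy zS; have wK := S_edge _ _ zw zS.
  by rewrite yK wK => _ E; rewrite E eqxx in yw'.
- have yK := S_edge _ _ xy xS; rewrite yK; case: ifPn => [_ _ E|wS xz yw].
    by rewrite E eqxx in yw'.
  have /negP[] := k_pair x w xS wS.
  by rewrite xz -yw xy wz.
- have yK := S_edge _ _ zy zS; have wK := S_edge _ _ zw zS.
  by rewrite yK wK => _ E; rewrite E eqxx in yw'.
Qed.

(** * Selections from intersecting families on four points *)

(** The last hypothesis excludes the missing sets of [G5].  The selection is
    constant when the family has a common point, cyclic when three points of
    [K] meet every member twice, and otherwise the excluded family appears. *)
Lemma selection_of_family (T : finType) (K : {set T}) (F : {set {set T}}) :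
  #|K| = 4 -> {in F, forall A : {set T}, A \subset K} ->
  {in F &, forall A B : {set T}, A :&: B != set0} ->
  (forall a b c d, K = [set a; b; c; d] ->
     ~ [/\ [set b; c; d] \in F, [set a; d] \in F, [set a; c] \in F
         & [set a; b] \in F]) ->
  exists k : {set T} -> T, {in F, forall A : {set T}, k A \in A} /\
    {in F &, forall A B : {set T}, (k A \in B) || (k B \in A)}.
Proof.
move=> cardK subK meet noG5.
have [/existsP[a /forall_inP Fa]|no_center] :=
    boolP [exists a : T, [forall A : {set T} in F, a \in A]].
  by exists (fun=> a); split=> [A|A B] AF => [|BF]; rewrite !Fa.
(* The three points are the elements of [K] other than [d]. *)
have [/exists_inP[d dK /forall_inP Fd]|no_triple] :=
    boolP [exists d in K, [forall A : {set T} in F, 1 < #|A :\ d|]].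
  have card3 : #|K :\ d| = 3 by move: cardK; rewrite (cardsD1 d) dK => -[].
  have two A x y : x \in K :\ d -> y \in K :\ d -> x != y -> A \in F ->
      (x \in A) || (y \in A).
    move=> xK yK xy AF; apply: contraLR (Fd A AF); rewrite negb_or -leqNgt.
    case/andP=> xA yA; have <- : #|K :\ d :\ x :\ y| = 1.
      have yKx : y \in K :\ d :\ x by rewrite in_setD1 eq_sym xy.
      by move: card3; rewrite (cardsD1 x) xK (cardsD1 y) yKx => -[].
    apply/subset_leq_card/subsetP=> z; rewrite in_setD1 => /andP[zd zA].
    rewrite !in_setD1 zd (subsetP (subK A AF) z zA) !andbT.
    by apply/andP; split; apply: contraTneq zA => ->.
  have [a aK] : exists a, a \in K :\ d by apply/card_gt0P; rewrite card3.
  have /cards2P[b [c] [bc Kab]] : #|K :\ d :\ a| == 2.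
    by move: card3; rewrite (cardsD1 a) aK => -[] <-.
  have : b \in K :\ d :\ a by rewrite Kab !inE eqxx.
  rewrite in_setD1 => /andP[ba bK].
  have : c \in K :\ d :\ a by rewrite Kab !inE eqxx orbT.
  rewrite in_setD1 => /andP[ca cK]; rewrite eq_sym in ba; rewrite eq_sym in ca.
  (* Cyclic choice: each of [ab], [bc], [ca] yields its first point, so that of
     any two of these pairs one contains the point chosen from the other. *)
  exists (fun A : {set T} => if a \in A then if b \in A then a else c else b).
  split=> [A AF|A B AF BF].
    have := two A a b aK bK ba AF; have := two A b c bK cK bc AF.
    by case aA: (a \in A); case bA: (b \in A).
  have := two A a b aK bK ba AF; have := two A b c bK cK bc AF.
  have := two A a c aK cK ca AF.
  have := two B a b aK bK ba BF; have := two B b c bK cK bc BF.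
  have := two B a c aK cK ca BF.
  case aA: (a \in A); case bA: (b \in A);
    case aB: (a \in B); case bB: (b \in B);
    by rewrite /= ?(aA, bA, aB, bB) ?orbT ?orbF // => *; apply/orP; auto.
(* A member with at most one point besides [d] is a pair through [d]: it is not
   empty, and a singleton would be a common point. *)
have pair d : d \in K -> exists2 e, e != d & [set d; e] \in F.
  move=> dK; move: no_triple; rewrite negb_exists_in => /forall_inP/(_ d dK).
  rewrite negb_forall_in => /exists_inP[A AF]; rewrite -leqNgt => cardA.
  have not1 x : A <> [set x].
    move=> Ax; case/existsP: no_center; exists x; apply/forall_inP=> B BF.
    have /set0Pn[y] := meet A B AF BF.
    by rewrite Ax !inE => /andP[/eqP->].
  have dA : d \in A.
    apply/negPn/negP => dA; move: cardA.
    have -> : A :\ d = A by apply/setDidPl; rewrite disjoint_sym disjoints1.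
    have := meet A A AF AF; rewrite setIid -card_gt0 => A_gt0 A_le1.
    have /cards1P[x /not1//] : #|A| == 1 by rewrite eqn_leq A_le1.
  move: cardA; rewrite leq_eqVlt ltnS leqn0 cards_eq0.
  case/orP=> [/cards1P[e Ae]|/eqP A0].
    exists e; last by rewrite -Ae setD1K.
    by have := set11 e; rewrite -Ae in_setD1 => /andP[].
  by case: (not1 d); rewrite -(setD1K dA) A0 setU0.
have /card_gt0P[p pK] : 0 < #|K| by rewrite cardK.
have [q qp pqF] := pair p pK.
have qK : q \in K by apply: (subsetP (subK _ pqF)); rewrite !inE eqxx orbT.
have /cards2P[r [s] [rs Krs]] : #|K :\ p :\ q| == 2.
  have qKp : q \in K :\ p by rewrite in_setD1 qp.
  by move: cardK; rewrite (cardsD1 p) pK (cardsD1 q) qKp => -[] <-.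
have: r \in K :\ p :\ q by rewrite Krs !inE eqxx.
have: s \in K :\ p :\ q by rewrite Krs !inE eqxx orbT.
rewrite !in_setD1 => /and3P[sq sp sK] /and3P[rq rp rK].
have KE : K = [set p; q; r; s].
  rewrite -(setD1K pK) -(@setD1K _ q (K :\ p)) ?in_setD1 ?qp // Krs.
  by apply/setP=> x; rewrite !inE -!orbA.
(* The pairs through [r] and [s] meet [pq] and each other, so they pass through
   the same point of [pq], which is the center of a star. *)
have [e er reF] := pair r rK; have [e' es seF] := pair s sK.
have epq : (e == p) || (e == q).
  have /set0Pn[x] := meet _ _ pqF reF; rewrite !inE => /andP[+ /orP[]/eqP xE].
    by rewrite xE (negPf rp) (negPf rq).
  by rewrite xE.
have epq' : (e' == p) || (e' == q).
  have /set0Pn[x] := meet _ _ pqF seF; rewrite !inE => /andP[+ /orP[]/eqP xE].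
    by rewrite xE (negPf sp) (negPf sq).
  by rewrite xE.
have ee' : e' = e.
  have /set0Pn[x] := meet _ _ reF seF; rewrite !inE => /andP[/orP[]/eqP->].
    rewrite (negPf rs) => /eqP re; move: epq'.
    by rewrite -re (negPf rp) (negPf rq).
  by case/orP=> /eqP // es'; move: epq; rewrite es' (negPf sp) (negPf sq).
(* Exchanging [p] and [q] if necessary, the center is [p]. *)
subst e'; wlog ep : p q qp pK qK pqF KE {Krs} sq sp rq rp epq {epq'} / e = p.
  move=> W; have [/eqP|/eqP] := orP epq; first by apply: (W p q).
  move=> eq; apply: (W q p) => //; last by rewrite orbC.
  - by rewrite eq_sym.
  - by rewrite setUC.
  by rewrite KE [[set p; q]]setUC.
subst e; have [M MF pM] : exists2 M, M \in F & p \notin M.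
  move: no_center; rewrite negb_exists => /forallP/(_ p).
  by rewrite negb_forall_in => /exists_inP.
have in_M x : [set x; p] \in F -> x \in M.
  move=> xpF; have /set0Pn[y] := meet _ _ xpF MF.
  by rewrite !inE => /andP[/orP[]/eqP->] //; rewrite (negPf pM).
have ME : M = [set q; r; s].
  apply/eqP; rewrite eqEsubset; apply/andP; split; last first.
    apply/subsetP=> x; rewrite !inE => /orP[/orP[]|] /eqP->; apply: in_M => //.
    by rewrite setUC.
  apply/subsetP=> x xM; have := subsetP (subK M MF) x xM.
  by rewrite KE !inE; case: eqP xM pM => [->->|].
case: (noG5 p q r s KE); split; rewrite -?ME // setUC //.
Qed.

(** * Embedding the listed graphs *)

Lemma complete_embeds (G : sgraph) (Q : {set G}) n :
  clique Q -> n <= #|Q| -> embeds (complete n) G.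
Proof.
move=> cliqueQ leQ; pose f (i : complete n) := enum_val (widen_ord leQ i).
have f_inj : injective f.
  by move=> i j /enum_val_inj /(congr1 val) /= ij; apply: val_inj.
exists f; split=> // i j; rewrite /= /complete_edge -(inj_eq f_inj).
have [<-|/eqP ij] := eqVneq (f i) (f j); first by rewrite edge_irrefl.
by apply: cliqueQ; rewrite ?enum_valP //; apply/eqP.
Qed.

(** Row [j] tells which of the labels [1, ..., n] belong to the [j]-th
    neighborhood.  On closed data it computes, so that both hypotheses on it in
    [split_of_embeds] become equations between lists of booleans. *)
Definition adjacency_table n (N : seq (seq nat)) : seq (seq bool) :=
  [seq [seq i \in A | i <- iota 1 n] | A <- N].

(** The vertices of [q] are distinct because their rows in the table are. *)
Lemma split_of_embeds (G : sgraph) (K : {set G}) n N (r q : seq G) :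
  clique K -> independent (~: K) -> {subset r <= K} -> {subset q <= ~: K} ->
  size r = n -> uniq r -> uniq (adjacency_table n N) ->
  [seq [seq edge x s | x <- r] | s <- q] = adjacency_table n N ->
  embeds (split_of n N) G.
Proof.
move=> cliqueK indepS rK qS r_size r_uniq N_uniq eq_table.
have q_size : size q = size N.
  by have := congr1 size eq_table; rewrite !size_map.
move: rK qS r_uniq eq_table.
rewrite -[r]/(tval (Tuple (introT eqP r_size))).
rewrite -[q]/(tval (Tuple (introT eqP q_size))).
move: (Tuple _) (Tuple _) => {q_size}q {r_size}r rK qS r_uniq eq_table.
have q_uniq : uniq q.
  apply: (@map_uniq _ _ (fun s => [seq edge x s | x <- r])).
  by rewrite eq_table.
have r_inj := tuple_uniqP _ r_uniq; have q_inj := tuple_uniqP _ q_uniq.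
have riK i : tnth r i \in K by apply/rK/mem_tnth.
have qjS j : tnth q j \in ~: K by apply/qS/mem_tnth.
have r_edge i i' : edge (tnth r i) (tnth r i') = (i != i').
  have [->|ii'] := eqVneq i i'; first by rewrite edge_irrefl.
  by apply: cliqueK; rewrite ?riK // (inj_eq r_inj).
have rq_edge i j : edge (tnth r i) (tnth q j) = (i.+1 \in nth [::] N j).
  have x0 := tnth q j.
  have := congr1 (fun t => nth false (nth [::] t j) i) eq_table.
  rewrite /adjacency_table (nth_map x0) ?size_tuple //.
  rewrite (nth_map x0) ?size_tuple //.
  rewrite (nth_map [::]) // (nth_map 0) ?size_iota // nth_iota // add1n.
  by rewrite -!tnth_nth.
pose f (u : split_of n N) :=
  match u with inl i => tnth r i | inr j => tnth q j end.
exists f; split=> [[i|j] [i'|j'] /= E|[i|j] [i'|j'] /=].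
- by rewrite (r_inj _ _ E).
- by have := qjS j'; rewrite -E inE riK.
- by have := qjS j; rewrite E inE riK.
- by rewrite (q_inj _ _ E).
- exact: r_edge.
- exact: rq_edge.
- by rewrite edge_sym rq_edge.
- by apply/negbTE/indepS.
Qed.

Definition missing (G : sgraph) (K : {set G}) (s : G) : {set G} :=
  [set x in K | ~~ edge x s].

(** With [s] missing at most as many vertices as [t], list [K] as: the vertices
    missed by [t], the common neighbors, the vertices missed by [s].  Then [s]
    sees an initial segment and [t] a final one, which is how the neighborhoods
    of [G1], ..., [G4] are written; the sizes of the three parts are (3,0,1),
    (2,1,1), (1,2,1) and (2,0,2) respectively. *)
Lemma disjoint_missing (G : sgraph) (K : {set G}) s t :
  clique K -> independent (~: K) -> #|K| = 4 -> s \notin K -> t \notin K ->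
  missing K s != set0 -> missing K t != set0 ->
  missing K s :&: missing K t = set0 ->
  exists2 H, F4sp H & embeds H G.
Proof.
move=> cliqueK indepS cardK.
wlog le_st : s t / #|missing K s| <= #|missing K t|.
  move=> W sK tK s0 t0 st.
  have /orP[le|le] := leq_total #|missing K s| #|missing K t|.
    exact: (W s t).
  by apply: (W t s); rewrite // setIC.
move=> sK tK; rewrite -!card_gt0 => s_gt0 t_gt0 disj_st.
pose B := K :\: (missing K s :|: missing K t).
pose r := enum (missing K t) ++ enum B ++ enum (missing K s).
have A_edge : all (fun x => edge x s && ~~ edge x t) (enum (missing K t)).
  apply/allP=> x; rewrite mem_enum => xt; have: x \notin missing K s.
    by apply/negP=> xs; have:= in_set0 x; rewrite -disj_st inE xs xt.
  by move: xt; rewrite !inE => /andP[-> ->]; rewrite negbK => ->.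
have B_edge : all (fun x => edge x s && edge x t) (enum B).
  apply/allP=> x; rewrite mem_enum !inE => /andP[+ xK].
  by rewrite xK negb_or !negbK.
have C_edge : all (fun x => ~~ edge x s && edge x t) (enum (missing K s)).
  apply/allP=> x; rewrite mem_enum => xs; have: x \notin missing K t.
    by apply/negP=> xt; have:= in_set0 x; rewrite -disj_st inE xs xt.
  by move: xs; rewrite !inE => /andP[-> ->]; rewrite negbK.
have rK : r =i K.
  move=> x; rewrite !mem_cat !mem_enum !inE.
  by case: (x \in K); case: (edge x s); case: (edge x t).
have r_uniq : uniq r.
  rewrite !cat_uniq !enum_uniq /= andbT; apply/andP; split.
    apply/hasPn=> x; rewrite mem_cat !mem_enum !inE => /orP[/andP[]|].
      by rewrite !negb_or => /andP[].
    move=> xs; apply/negP=> xt; have := in_set0 x.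
    by rewrite -disj_st !inE xs xt.
  by apply/hasPn=> x; rewrite !mem_enum !inE => ->.
have r_size : size (enum (missing K t)) + size (enum (missing K s))
    + size (enum B) = 4.
  rewrite addnAC -addnA -!size_cat -cardK -(eq_card rK).
  exact/esym/card_uniqP.
have qS : {subset [:: s; t] <= ~: K}.
  by move=> x; rewrite !inE => /orP[]/eqP->.
move: s_gt0 le_st r_size A_edge B_edge C_edge rK r_uniq; rewrite {}/r !cardE.
move: (enum _) (enum B) (enum (missing K s)) => A {}B C.
case: A => [|a1 [|a2 [|a3 [|? ?]]]]; case: C => [|c1 [|c2 [|? ?]]] //;
  (* Only the four admissible triples of sizes survive. *)
  case: B => [|b1 [|b2 [|? ?]]]; rewrite //= !(addSn, addnS) //;
  move=> _ _ _ A_edge B_edge C_edge rK r_uniq.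
- exists G3; first by rewrite /F4sp; tauto.
  apply: (@split_of_embeds _ K _ _ [:: a1; b1; b2; c1] [:: s; t]) => //=.
    by move=> x; rewrite rK.
  by move: A_edge B_edge C_edge; do 8?[case: (edge _ _) => //].
- exists G2; first by rewrite /F4sp; tauto.
  apply: (@split_of_embeds _ K _ _ [:: a1; a2; b1; c1] [:: s; t]) => //=.
    by move=> x; rewrite rK.
  by move: A_edge B_edge C_edge; do 8?[case: (edge _ _) => //].
- exists G4; first by rewrite /F4sp; tauto.
  apply: (@split_of_embeds _ K _ _ [:: a1; a2; c1; c2] [:: s; t]) => //=.
    by move=> x; rewrite rK.
  by move: A_edge B_edge C_edge; do 8?[case: (edge _ _) => //].
- exists G1; first by rewrite /F4sp; tauto.
  apply: (@split_of_embeds _ K _ _ [:: a1; a2; a3; c1] [:: s; t]) => //=.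
    by move=> x; rewrite rK.
  by move: A_edge B_edge C_edge; do 8?[case: (edge _ _) => //].
Qed.

(** * Both directions *)

Lemma complete_star_colorable m n : star_colorable (complete m) n -> m <= n.
Proof.
move=> [c [c_proper _]]; rewrite -(card_ord m) -(card_ord n).
apply: (@leq_card _ _ c) => i j cij; apply: contra_eq cij => ij.
exact: c_proper.
Qed.

(** The selection is expressed by the labels [1, ..., n] of the clique vertices
    and by plain indices [j], so that for concrete neighborhoods its conditions
    reduce to finitely many equations between numerals. *)
Lemma split_of_selection n N :
  star_colorable (split_of n N) n ->
  exists k : nat -> nat,
    (forall j, j < size N ->
       k j \in [seq i <- iota 1 n | i \notin nth [::] N j]) /\
    (forall j j', j < size N -> j' < size N ->
       ~~ ((k j' \in nth [::] N j) && (k j \in nth [::] N j'))).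
Proof.
pose K : {set split_of n N} := [set inl i | i : 'I_n].
have inrK j : (inr j : split_of n N) \notin K by apply/imsetP=> -[].
have cliqueK : clique K.
  by move=> _ _ /imsetP[i _ ->] /imsetP[i' _ ->]; apply: contraNneq => ->.
have cardK : #|K| = n by rewrite card_imset ?card_ord // => i i' [].
move=> /(star_colorable_selection cliqueK cardK)[k [kP k_pair]].
have [i kE] : exists i : 'I_(size N) -> 'I_n, forall j, k (inr j) = inl (i j).
  have k_inl j : exists i, k (inr j) == inl i.
    by have [/imsetP[i _ ->] _] := kP _ (inrK j); exists i.
  by exists (fun j => xchoose (k_inl j)) => j; apply/eqP/(xchooseP (k_inl j)).
exists (fun j => oapp (fun j' => (i j').+1) 0 (insub j)).
split=> [j ltj|j j' ltj ltj'].
  rewrite insubT mem_filter mem_iota /= ltnS ltn_ord andbT.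
  by have [_] := kP _ (inrK (Ordinal ltj)); rewrite kE.
rewrite !insubT; have := k_pair _ _ (inrK (Ordinal ltj)) (inrK (Ordinal ltj')).
by rewrite !kE.
Qed.

Lemma F4sp_not_star_colorable H : F4sp H -> ~ star_colorable H 4.
Proof.
case=> [->|]; first by move/complete_star_colorable.
case=> [|[|[|[]]]] -> /split_of_selection[k [/= kN k_pair]]; last first.
(* For [G5] a selection is an element of a product of four sets of sizes
   3, 2, 2, 2; each of these 24 choices violates one of the six pairs. *)
- move: (kN 0 isT) (kN 1 isT) (kN 2 isT) (kN 3 isT).
  move: (k_pair 0 1 isT isT) (k_pair 0 2 isT isT) (k_pair 0 3 isT isT).
  move: (k_pair 1 2 isT isT) (k_pair 1 3 isT isT) (k_pair 2 3 isT isT).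
  rewrite /= !inE => p23 p13 p12 p03 p02 p01.
  case/or3P=> /eqP k0 /orP[]/eqP k1 /orP[]/eqP k2 /orP[]/eqP k3;
  by move: p01 p02 p03 p12 p13 p23; rewrite k0 k1 k2 k3.
(* For the others the two missing sets are disjoint, so that every choice
   violates the pair condition. *)
all: have /negP[] := k_pair 0 1 isT isT.
all: move: (kN 0 isT) (kN 1 isT); rewrite /= !inE.
all: by do ?[case/orP | move/eqP->].
Qed.

Lemma F4sp_free_star_colorable (G : sgraph) (K : {set G}) :
  clique K -> independent (~: K) -> (forall H, F4sp H -> ~ embeds H G) ->
  star_colorable G 4.
Proof.
move=> cliqueK indepS freeG.
have [gtK|leK] := ltnP 4 #|K|.
  by case: (freeG (complete 5)); [left | apply: complete_embeds gtK].
move: leK; rewrite leq_eqVlt => /orP[/eqP cardK|]; last first.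
  exact: independent_star_colorable.
pose F := [set missing K s | s in ~: K].
have missing0 s : s \notin K -> missing K s != set0.
  (* A vertex that misses nothing extends [K] to a clique of size five. *)
  move=> sK; have freeK5 := freeG (complete 5) (or_introl erefl).
  apply: contra_notN freeK5 => /eqP s0.
  apply: (@complete_embeds _ (s |: K)); last by rewrite cardsU1 sK cardK.
  have s_adj x : x \in K -> edge x s.
    move=> xK; apply: contraFT (in_set0 x) => xs.
    by rewrite -s0 inE xK.
  move=> x y; rewrite !inE => /predU1P[->|xK] /predU1P[->|yK].
  - by rewrite eqxx.
  - by rewrite edge_sym s_adj.
  - by rewrite s_adj.
  - exact: cliqueK.
have [|||k [k_in k_pair]] := @selection_of_family _ K F cardK.
- move=> _ /imsetP[s _ ->]; apply/subsetP=> x.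
  by rewrite inE => /andP[].
- move=> _ _ /imsetP[s + ->] /imsetP[t + ->]; rewrite !inE => sK tK.
  apply/eqP=> /(disjoint_missing cliqueK indepS cardK sK tK).
  by case/(_ (missing0 _ sK) (missing0 _ tK)) => H /freeG.
- move=> a b c d KE [/imsetP[s0 s0K E0] /imsetP[s1 s1K E1] /imsetP[s2 s2K E2]
    /imsetP[s3 s3K E3]].
  have abcd : uniq [:: a; b; c; d].
    apply/card_uniqP; rewrite -[RHS]cardK; apply: eq_card => x.
    by rewrite KE !inE -!orbA.
  case: (freeG G5); first by rewrite /F4sp; tauto.
  apply: (@split_of_embeds _ K _ _ [:: a; b; c; d] [:: s0; s1; s2; s3]) => //=.
  + by move=> x; rewrite KE !inE -!orbA.
  + by move=> x; rewrite !inE => /or4P[]/eqP->; rewrite -in_setC.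
  + have edgeE s A : A = missing K s ->
        [seq edge x s | x <- [:: a; b; c; d]]
        = [seq x \notin A | x <- [:: a; b; c; d]].
      move=> ->; apply/eq_in_map=> x xabcd; rewrite inE.
      have -> : x \in K by rewrite KE !inE -!orbA; rewrite !inE in xabcd.
      by rewrite negbK.
    move: (edgeE _ _ E0) (edgeE _ _ E1) (edgeE _ _ E2) (edgeE _ _ E3).
    rewrite /= !inE => -> -> -> ->.
    move: abcd; rewrite /= !inE !eqxx !negb_or andbT.
    move=> /and3P[/and3P[ab ac ad] /andP[bc bd] cd].
    rewrite !(eq_sym _ a) !(eq_sym c b) !(eq_sym d b) !(eq_sym d c).
    by rewrite !(negPf ab, negPf ac, negPf ad, negPf bc, negPf bd, negPf cd).
apply: (@selection_star_colorable _ K 4 (k \o missing K)) => //.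
have sF s : s \notin K -> missing K s \in F.
  by move=> sK; apply: imset_f; rewrite inE.
split=> [s sK|s t sK tK] /=.
  by have := k_in _ (sF s sK); rewrite inE edge_sym => /andP[].
have /orP[] := k_pair _ _ (sF s sK) (sF t tK); rewrite inE edge_sym => /andP[_].
  by rewrite negb_and => ->; rewrite orbT.
by rewrite negb_and => ->.
Qed.

Theorem proposition3p9 (G : sgraph) :
  split_graph G -> (star_colorable G 4 <-> is_free F4sp G).
Proof.
move=> [K [S [KS disjKS cliqueK indepS]]]; split=> [colG H FH|freeG].
  move/induced_copyP=> /star_colorable_embeds/(_ colG).
  exact: F4sp_not_star_colorable.
apply: F4sp_free_star_colorable cliqueK _ _ => [x y xS yS|H FH /induced_copyP].
  have sub z : z \in ~: K -> z \in S.
    by have := in_setT z; rewrite -KS !inE => /orP[->|].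
  by apply: indepS; apply: sub.
exact: freeG.
Qed.
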